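(* Let $\tilde u_{*,i}\in V$ for $i=r,r+1,\dots,s$ be arbitrary. Let $\widetilde V_*=\operatorname{span}\{\tilde u_{*,r},\tilde u_{*,r+1},\dots,\tilde u_{*,s}\}$. Let $\lambda_{*,i}>0$ and $u_{*,i}\in\widetilde V_*$, $|u_{*,i}|_b=1$, $i=r,r+1,\dots,s$, be the eigenvalues sorted in ascending order and the corresponding eigenfunctions of the problem $$a(u_{*,i},v_* )=\lambda_{*,i}\,b(u_{*,i},v_* )\quad\forall v_*\in\widetilde V_*.$$ Let there exist $\nu>0$ satisfying $$\lambda_{s-1}\le\lambda_{*,s}<\nu\le\lambda_{s+1},$$ where $\lambda_{s-1}$ and $\lambda_{s+1}$ are eigenvalues of the eigenvalue problem on $V$ given in the context. Further, for all $i=r,r+1,\dots,s$ let $w_i\in V$ be given by $$a(w_i,v)=a(u_{*,i},v)-\lambda_{*,i}\,b(u_{*,i},v)\quad\forall v\in V,$$ and let $\eta_i>0$ satisfy $\|w_i\|_a\le\eta_i$. Then $$L_n=\lambda_{*,n}\left(1+\nu\lambda_{*,n}\sum_{i=n}^s\frac{\eta_i^2}{\lambda_{*,i}^2(\nu-\lambda_{*,i})}\right)^{-1}$$ satisfies $L_n\le\lambda_n$ for all $n=r,r+1,\dots,s$.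
   Context: $V$ is a real Hilbert space with scalar product $a(\cdot,\cdot)$ and norm $\|v\|_a=a(v,v)^{1/2}$. The form $b(\cdot,\cdot)$ on $V$ is continuous, bilinear, symmetric and positive semidefinite, with seminorm $|v|_b=b(v,v)^{1/2}$. The seminorm $|\cdot|_b$ is assumed compact with respect to $\|\cdot\|_a$: from any sequence bounded in $\|\cdot\|_a$ one can extract a subsequence which is Cauchy in $|\cdot|_b$. The eigenvalue problem on $V$ is: find $\lambda_i\in\mathbb{R}$ and $u_i\in V\setminus\{0\}$ with $a(u_i,v)=\lambda_i b(u_i,v)$ for all $v\in V$. Its eigenvalues form an at most countable sequence $0<\lambda_1\le\lambda_2\le\lambda_3\le\cdots$, and the corresponding eigenfunctions are normalized by $b(u_i,u_j)=\delta_{ij}$.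
   Formalization: The eigenfunctions u_{*,i} are taken b-orthonormal, not only with |u_{*,i}|_b = 1; this matters only for repeated eigenvalues λ_{*,i}, where the bound fails for non-orthogonal eigenfunctions. For s = 1 the condition on λ_{s-1} is void. *)

(* Defs.v *)
From HB Require Import structures.
From mathcomp Require Import all_boot all_order all_algebra.
From mathcomp Require Import all_classical all_reals all_analysis.

Set Implicit Arguments.
Unset Strict Implicit.
Unset Printing Implicit Defensive.

Import Order.TTheory GRing.Theory Num.Theory.
Import numFieldNormedType.Exports.

Local Open Scope classical_set_scope.
Local Open Scope ring_scope.

Definition form_norm (R : realType) (V : lmodType R) (f : V -> V -> R) (v : V)
  : R := Num.sqrt (f v v).

(* Extraction of an N-Cauchy subsequence from every norm-bounded sequence. *)
Definition compact_seminorm (R : realType) (V : normedModType R) (N : V -> R) :=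
  forall x : nat -> V, (exists M : R, forall k, `|x k| <= M) ->
    exists2 phi : nat -> nat, increasing_seq phi &
      forall e : R, 0 < e -> exists K : nat, forall j k : nat,
        (K <= j)%N -> (K <= k)%N -> N (x (phi j) - x (phi k)) < e.

Definition lspan (R : realType) (V : lmodType R) (A : set V) : set V :=
  [set v | exists (n : nat) (c : 'I_n -> R) (x : 'I_n -> V),
     (forall i, A (x i)) /\ v = \sum_(i < n) c i *: x i].

Definition eigenpair (R : realType) (V : lmodType R) (a b : V -> V -> R)
    (W : set V) (l : R) (u : V) :=
  [/\ W u, u != 0 & forall v, W v -> a u v = l * b u v].

(* The family (lam i, u i), for i in I, lists all the eigenvalues of the
   problem on W in ascending order together with b-orthonormal eigenfunctions.
   The last clause says that the list is exhaustive and that each eigenvalue is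
   repeated according to its multiplicity: the u i with lam i = l span the
   eigenspace of l. Values of lam and u outside I are irrelevant. *)
Definition eigen_listing (R : realType) (V : lmodType R) (a b : V -> V -> R)
    (W : set V) (I : set nat) (lam : nat -> R) (u : nat -> V) :=
  [/\ forall i, I i -> eigenpair a b W (lam i) (u i),
      forall i j, I i -> I j -> b (u i) (u j) = (i == j)%:R,
      forall i j, I i -> I j -> (i <= j)%N -> lam i <= lam j
    & forall l v, eigenpair a b W l v ->
        lspan (u @` [set i | I i /\ lam i = l]) v].

(* I is {1, ..., N} for some N, or the set of all positive integers. *)
Definition initial_segment (I : set nat) :=
  ~ I 0%N /\ forall i j, (0 < i <= j)%N -> I j -> I i.

(* Main.v *)
Require Import Defs.
From HB Require Import structures.
From mathcomp Require Import all_boot all_order all_algebra.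
From mathcomp Require Import all_classical all_reals all_analysis.
From mathcomp Require Import ring lra.

Set Implicit Arguments.
Unset Strict Implicit.
Unset Printing Implicit Defensive.

Import Order.TTheory GRing.Theory Num.Theory.
Import numFieldNormedType.Exports.

Local Open Scope classical_set_scope.
Local Open Scope ring_scope.

(** Write L_n for the claimed bound, put rho = lam n, and let T v denote the
    solution g of a(g, x) = b(v, x) for all x. Everything rests on the signs of
    the quadratic form
      Q(v) = a(v, v) - (rho + nu) b(v, v) + rho nu b(T v, v).
    On an eigenvector normalized by b, with eigenvalue l, it takes the value
    (l - rho) (l - nu) / l, which is negative only if l lies strictly between
    rho and nu. Since lam s.+1 >= nu, among all the eigenfunctions only
    u_(n+1), ..., u_s can make Q negative, so Q is nonnegative on their
    b-orthogonal complement, a subspace of codimension s - n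
    ([lehmann_form_ge0]).

    On the span of us_n, ..., us_s, of dimension s - n + 1, the image T v is
    explicit: T us_i = (us_i - w_i) / lamt_i. The residuals w_i are a-orthogonal
    to the trial space, so for v = sum_i d_i us_i
      Q(v) = sum_i d_i^2 (lamt_i - rho) (lamt_i - nu) / lamt_i
             + rho nu |sum_i (d_i / lamt_i) w_i|_a^2.
    A weighted Cauchy-Schwarz inequality with weights nu - lamt_i bounds the
    last norm, and rho < L_n is exactly what makes the total negative for every
    nonzero v ([lehmann_form_lt0]). The trial space being one dimension too
    large to avoid the complement above, rho < L_n is absurd.

    The spectrum enters the nonnegativity of Q through a single fact: on the
    b-orthogonal complement of u_1, ..., u_s one has
    lam s.+1 * b(v, v) <= a(v, v) ([spectral_gap]). Indeed, by compactness of
    the seminorm of b, the quotient b / a attains its supremum on this closed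
    subspace ([rayleigh_sup_attained]); a maximizer is an eigenvector, and as
    the listing of eigenpairs is exhaustive its eigenvalue is some lam j with
    j > s. *)

(** * Symmetric bilinear forms *)

Lemma symm_formC {R : realType} {V : lmodType R} (f : {symmetric V}) (x y : V) :
  f x y = f y x.
Proof. by rewrite (hermC f) expr0 mul1r. Qed.

Lemma symm_formDl {R : realType} {V : lmodType R} (f : {symmetric V})
  (x y z : V) : f (x + y) z = f x z + f y z.
Proof. exact: linearDl. Qed.

Lemma symm_formZl {R : realType} {V : lmodType R} (f : {symmetric V}) (c : R)
  (x z : V) : f (c *: x) z = c * f x z.
Proof. exact: linearZl_LR. Qed.

Lemma symm_form0l {R : realType} {V : lmodType R} (f : {symmetric V}) (z : V) :
  f 0 z = 0.
Proof. exact: linear0l. Qed.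

Lemma symm_formNl {R : realType} {V : lmodType R} (f : {symmetric V})
  (x z : V) : f (- x) z = - f x z.
Proof. exact: linearNl. Qed.

Lemma symm_form_suml {R : realType} {V : lmodType R} (f : {symmetric V})
  (J : Type) (r : seq J) (P : pred J) (F : J -> V) (z : V) :
  f (\sum_(j <- r | P j) F j) z = \sum_(j <- r | P j) f (F j) z.
Proof. exact: linear_sumlz. Qed.

Lemma symm_formDr {R : realType} {V : lmodType R} (f : {symmetric V})
  (x y z : V) : f z (x + y) = f z x + f z y.
Proof. by rewrite !(symm_formC f z) symm_formDl. Qed.

Lemma symm_formZr {R : realType} {V : lmodType R} (f : {symmetric V}) (c : R)
  (x z : V) : f z (c *: x) = c * f z x.
Proof. by rewrite !(symm_formC f z) symm_formZl. Qed.

Lemma symm_formNr {R : realType} {V : lmodType R} (f : {symmetric V})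
  (x z : V) : f z (- x) = - f z x.
Proof. by rewrite !(symm_formC f z) symm_formNl. Qed.

Lemma symm_form_sumr {R : realType} {V : lmodType R} (f : {symmetric V})
  (J : Type) (r : seq J) (P : pred J) (F : J -> V) (z : V) :
  f z (\sum_(j <- r | P j) F j) = \sum_(j <- r | P j) f z (F j).
Proof.
by rewrite symm_formC symm_form_suml; apply: eq_bigr => j _; rewrite symm_formC.
Qed.

Definition symm_formE := (@symm_formDl, @symm_formDr, @symm_formZl,
  @symm_formZr, @symm_formNl, @symm_formNr).

Lemma form_norm_sqr {R : realType} {V : lmodType R} (f : {symmetric V})
  (x : V) :
  0 <= f x x -> form_norm f x ^+ 2 = f x x.
Proof. exact: sqr_sqrtr. Qed.

(** * Maximizing the Rayleigh quotient *)

(** Euler-Lagrange equation: m a - b is nonnegative on the subspace W and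
    vanishes at v, so v is in its kernel. *)
Lemma rayleigh_stationary {R : realType} {V : lmodType R} (a b : {symmetric V})
    (W : set V) (m : R) (v : V) :
  (forall c x y, W x -> W y -> W (x + c *: y)) -> W v ->
  (forall x, W x -> b x x <= m * a x x) -> b v v = m * a v v ->
  forall x, W x -> b v x = m * a v x.
Proof.
move=> W_lin Wv b_le bv x Wx.
set p := m * a v x - b v x; set q := m * a x x - b x x.
have q_ge0 : 0 <= q by rewrite subr_ge0 b_le.
have quad t : 0 <= t ^+ 2 * q + 2 * t * p.
  have := b_le _ (W_lin t _ _ Wv Wx).
  rewrite !symm_formE !(symm_formC _ x v) bv -subr_ge0 /q /p.
  by congr (_ <= _); ring.
have q1_gt0 : 0 < q + 1 by lra.
(* The value of the quadratic polynomial at t = - p / (q + 1) is a negative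
   multiple of p^2; q + 1 rather than q because q may vanish. *)
have : 0 <= - (p ^+ 2 * ((q + 2) / (q + 1) ^+ 2)).
  have := quad (- p / (q + 1)); congr (_ <= _); field; exact: lt0r_neq0.
have c_gt0 : 0 < (q + 2) / (q + 1) ^+ 2 by rewrite divr_gt0 ?exprn_gt0//; lra.
rewrite oppr_ge0 pmulr_lle0// => p2_le0.
have : p ^+ 2 == 0 by rewrite eq_le p2_le0 sqr_ge0.
by rewrite sqrf_eq0 subr_eq0 => /eqP ->.
Qed.

Lemma continuous_form_bounded {R : realType} {V : normedModType R}
    (b : {symmetric V}) (b_cont : continuous (fun p : V * V => b p.1 p.2 : R)) :
  exists C : R, forall v, b v v <= C * `|v| ^+ 2.
Proof.
have b00 : b 0 0 = 0 by rewrite symm_form0l.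
have /cvgrPdist_lt /(_ 1 ltr01) :
    (fun p : V * V => b p.1 p.2 : R) @ (0, 0) --> (0 : R).
  by have := b_cont (0, 0); rewrite /continuous_at /= b00.
move=> [[A B] /= [/nbhs_ballP[e1 e1_gt0 Ae] /nbhs_ballP[e2 e2_gt0 Be]] AB].
pose e := Num.min e1 e2 / 2.
have e12_gt0 : 0 < Num.min e1 e2 by rewrite lt_min e1_gt0.
have e_gt0 : 0 < e by rewrite divr_gt0.
have small v : `|v| <= e -> b v v <= 1.
  move=> ve; have ve' : `|v| < Num.min e1 e2.
    by rewrite (le_lt_trans ve)// /e ltr_pdivrMr//; lra.
  move: ve'; rewrite lt_min => /andP[v1 v2].
  have := AB (v, v); rewrite /= sub0r normrN => /(_ _)/ltW H.
  apply: le_trans (ler_norm _) (H _); split.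
    by apply: Ae; rewrite -ball_normE /= sub0r normrN.
  by apply: Be; rewrite -ball_normE /= sub0r normrN.
exists (e ^- 2) => v.
have [->|v_neq0] := eqVneq v 0.
  by rewrite b00 normr0 expr0n mulr0.
have nv_gt0 : 0 < `|v| by rewrite normr_gt0.
have := small ((e / `|v|) *: v).
have c_ge0 : 0 <= e / `|v| by rewrite divr_ge0 ?ltW.
rewrite normrZ (ger0_norm c_ge0) divfK ?gt_eqF// lexx => /(_ isT).
rewrite !symm_formE => H.
have -> : b v v = e / `|v| * (e / `|v| * b v v) * (e ^- 2 * `|v| ^+ 2).
  by field; rewrite !gt_eqF.
by rewrite ler_piMl// mulr_ge0 ?invr_ge0 ?exprn_ge0// ltW.
Qed.

(** A normalized maximizing sequence has a subsequence that is Cauchy for the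
    seminorm of b. By the parallelogram law for a and b, it is then also Cauchy
    for the norm of a: two almost maximal unit vectors that are b-close have
    a midpoint whose quotient would exceed the supremum m unless they are
    a-close. The limit attains m. *)
Lemma rayleigh_sup_attained {R : realType} {V : completeNormedModType R}
    (a b : {symmetric V}) (W : set V) (x0 : V) :
  (forall v : V, `|v| ^+ 2 = a v v) ->
  continuous (fun p : V * V => b p.1 p.2 : R) ->
  compact_seminorm (form_norm b) ->
  closed W -> (forall c x y, W x -> W y -> W (x + c *: y)) ->
  W x0 -> 0 < b x0 x0 ->
  exists m v, [/\ 0 < m, W v, a v v = 1, b v v = m &
    forall x, W x -> b x x <= m * a x x].
Proof.
move=> a_norm b_cont b_compact W_closed W_lin Wx0 bx0.
have [C b_le] := continuous_form_bounded b_cont.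
have a_gt0 v : 0 < b v v -> 0 < a v v.
  move=> bv; rewrite -a_norm exprn_gt0// normr_gt0; apply: contraTneq bv => ->.
  by rewrite symm_form0l ltxx.
have W0 : W 0 by have := W_lin (-1) _ _ Wx0 Wx0; rewrite scaleN1r subrr.
pose S := [set b v v | v in [set v | W v /\ `|v| = 1]].
have ratioS x : W x -> 0 < a x x -> S (b x x / a x x).
  move=> Wx ax; exists (`|x|^-1 *: x); last first.
    by rewrite !symm_formE mulrA -expr2 exprVn a_norm mulrC.
  have nx : `|x| != 0.
    by apply: contraTneq ax => nx; rewrite -a_norm nx expr0n ltxx.
  split; first by rewrite -[_ *: _]add0r; apply: W_lin.
  by rewrite normrZ normfV normr_id mulVf.
have S_sup : has_sup S.
  split; first by exists (b x0 x0 / a x0 x0); apply: ratioS => //; exact: a_gt0.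
  by exists C => _ [v [_ v1] <-]; have := b_le v; rewrite v1 expr1n mulr1.
set m := sup S.
have ratio_le x : W x -> 0 < a x x -> b x x / a x x <= m.
  by move=> Wx ax; apply: sup_upper_bound => //; apply: ratioS.
have m_gt0 : 0 < m.
  by apply: lt_le_trans (ratio_le _ Wx0 (a_gt0 _ bx0)); rewrite divr_gt0 ?a_gt0.
have m_ub x : W x -> b x x <= m * a x x.
  move=> Wx; have [bx|bx] := ltP 0 (b x x); last first.
    by rewrite (le_trans bx)// mulr_ge0 ?(ltW m_gt0)// -a_norm exprn_ge0.
  by rewrite -ler_pdivrMr ?a_gt0// ratio_le ?a_gt0.
have approx (k : nat) : exists v, [/\ W v, `|v| = 1 & m - k.+1%:R^-1 < b v v].
  have [|_ [v [Wv v1] <-] mv] := @sup_adherent _ S k.+1%:R^-1 _ S_sup.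
    by rewrite invr_gt0 ltr0n.
  by exists v.
have {approx} [x xP] := choice approx.
have [|phi phi_incr phi_cauchy] := b_compact x.
  by exists 1 => k; have [_ -> _] := xP k.
pose y k := x (phi k).
have phi_ge k : (k <= phi k)%N.
  elim: k => // k IH; rewrite (leq_ltn_trans IH)//.
  by have := leW_mono phi_incr k k.+1; rewrite !ltEnat /= ltnSn.
have Wy k : W (y k) by have [] := xP (phi k).
have ny k : `|y k| = 1 by have [] := xP (phi k).
have by_ge k : m - k.+1%:R^-1 < b (y k) (y k).
  have [_ _] := xP (phi k); apply: le_lt_trans.
  by rewrite lerD2l lerN2 lef_pV2 ?posrE ?ltr0n// ler_nat ltnS.
have by_le k : b (y k) (y k) <= m.
  by have := m_ub _ (Wy k); rewrite -a_norm ny expr1n mulr1.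
have dist_le j k : m * `|y j - y k| ^+ 2 <=
    2 * (m - b (y j) (y j)) + 2 * (m - b (y k) (y k)) +
    b (y j - y k) (y j - y k).
  (* Maximality of m applied to y j + y k. *)
  have := m_ub _ (W_lin 1 _ _ (Wy j) (Wy k)).
  rewrite scale1r a_norm !symm_formE !(symm_formC _ (y k) (y j)).
  rewrite -!a_norm !ny; lra.
have y_cauchy : cauchy (y @ \oo).
  apply/cauchy_ballP => e e_gt0; rewrite near_map2.
  have d_gt0 : 0 < m * e ^+ 2 by rewrite mulr_gt0// exprn_gt0.
  (* In dist_le each gap m - b is counted twice and gets m e^2 / 8, and the
     b-distance gets m e^2 / 2: the total is m e^2. *)
  have [|K phiK] := phi_cauchy (Num.sqrt (m * e ^+ 2 / 2)).
    by rewrite sqrtr_gt0 divr_gt0.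
  have d8_gt0 : 0 < m * e ^+ 2 / 8 by rewrite divr_gt0.
  have inv_lt := near_infty_natSinv_lt (PosNum d8_gt0).
  near=> j k; rewrite -ball_normE /=.
  rewrite -ltr_sqr ?nnegrE ?(ltW e_gt0)// -(ltr_pM2l m_gt0).
  apply: le_lt_trans (dist_le j k) _.
  have bj : m - b (y j) (y j) < m * e ^+ 2 / 8.
    by apply: (@lt_trans _ _ j.+1%:R^-1); [rewrite ltrBlDl -ltrBlDr|near: j].
  have bk : m - b (y k) (y k) < m * e ^+ 2 / 8.
    by apply: (@lt_trans _ _ k.+1%:R^-1); [rewrite ltrBlDl -ltrBlDr|near: k].
  have : form_norm b (y j - y k) < Num.sqrt (m * e ^+ 2 / 2).
    by apply: phiK; [near: j|near: k]; exact: nbhs_infty_ge.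
  rewrite ltr_sqrt ?divr_gt0// => bjk; lra.
have yv : cvg (y @ \oo) by exact: cauchy_cvg.
set v : V := lim (y @ \oo) in yv.
have Wv : W v.
  exact: (@closed_cvg _ _ _ _ y W W_closed (nearW _ Wy) v yv).
have norm_cvg : (fun k => `|y k|) @ \oo --> (`|v| : R).
  exact: cvg_norm.
have nv : `|v| = 1.
  have nyE : (fun k => `|y k|) = fun=> 1 by apply/funext.
  rewrite nyE in norm_cvg; rewrite -(cvg_lim (@Rhausdorff R) norm_cvg).
  exact: lim_cst.
have b_cvg : (fun k => b (y k) (y k)) @ \oo --> b v v.
  exact: (cvg_comp _ _ (cvg_pair yv yv) (b_cont (v, v))).
exists m, v; split => //; first by rewrite -a_norm nv expr1n.
rewrite -(cvg_lim (@Rhausdorff R) b_cvg); apply: cvg_lim => //.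
apply: (squeeze_cvgr (f := fun k => m - k.+1%:R^-1) (h := fun=> m)).
- by apply: nearW => k; rewrite by_le (ltW (by_ge k)).
- rewrite -[X in _ --> X]subr0; apply: cvgB; first exact: cvg_cst.
  exact: cvg_harmonic.
- exact: cvg_cst.
Unshelve. all: by end_near. Qed.

(** * The spectral gap *)

Lemma form_orthonormal_remainder {R : realType} {V : lmodType R}
    (b : {symmetric V}) (k : nat) (e : 'I_k -> V) (x : V) :
  (forall i j, b (e i) (e j) = (i == j)%:R) ->
  forall i, b (x - \sum_j b x (e j) *: e j) (e i) = 0.
Proof.
move=> e_on i; rewrite !symm_formE symm_form_suml (bigD1 i)//= big1 => [|j ji].
  by rewrite !symm_formE e_on eqxx mulr1 addr0 subrr.
by rewrite !symm_formE e_on (negbTE ji) mulr0.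
Qed.

(** The maximizer y of b / a on the orthogonal complement W of u_1, ..., u_s
    satisfies the eigenvalue equation against all of V, because both forms
    vanish between y and the span of the u_i. Its eigenvalue 1 / m cannot be
    below lam s.+1: otherwise y would be a combination of u_1, ..., u_s, to
    which it is b-orthogonal, contradicting b(y, y) = m > 0. *)
Lemma spectral_gap {R : realType} {V : completeNormedModType R}
    (a b : {symmetric V}) (I : set nat) (lam : nat -> R) (u : nat -> V)
    (s : nat) :
  (forall v : V, `|v| ^+ 2 = a v v) ->
  continuous (fun p : V * V => b p.1 p.2 : R) ->
  compact_seminorm (form_norm b) ->
  initial_segment I -> eigen_listing a b setT I lam u -> I s.+1 ->
  forall v, (forall i : 'I_s, b v (u i.+1) = 0) ->
    lam s.+1 * b v v <= a v v.
Proof.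
move=> a_norm b_cont b_compact [I0 I_seg] [u_eig u_on lam_mono u_all] Is1.
move=> v v_orth.
have Iu (i : 'I_s) : I i.+1 by apply: I_seg Is1; rewrite /= ltnS ltnW.
have eigE i x : I i -> a (u i) x = lam i * b (u i) x.
  by move=> /u_eig[_ _ uE]; exact: uE.
have a_ge0 x : 0 <= a x x by rewrite -a_norm exprn_ge0.
have lam_ge0 : 0 <= lam s.+1.
  by have := a_ge0 (u s.+1); rewrite eigE// u_on// eqxx mulr1.
have [bv|bv] := ltP 0 (b v v); last first.
  by rewrite (le_trans _ (a_ge0 v))// mulr_ge0_le0.
pose W := [set x | forall i : 'I_s, b x (u i.+1) = 0].
have W_closed : closed W.
  have -> : W = \bigcap_(i in [set: 'I_s]) (fun x => b x (u i.+1)) @^-1` [set 0].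
    by apply/seteqP; split => x /= Wx i => [_|]; apply: Wx.
  apply: closed_bigI => i _; apply: preimage_closed; last exact: closed_eq.
  move=> x _.
  have pair_cvg : (fun z => (z, u i.+1)) z @[z --> x] --> (x, u i.+1).
    by apply: cvg_pair; [exact: cvg_id|exact: cvg_cst].
  exact: (cvg_comp _ _ pair_cvg (b_cont (x, u i.+1))).
have W_lin c x y : W x -> W y -> W (x + c *: y).
  by move=> Wx Wy i; rewrite !symm_formE Wx Wy mulr0 addr0.
have [m [y [m_gt0 Wy ay bym b_le]]] :=
  rayleigh_sup_attained a_norm b_cont b_compact W_closed W_lin v_orth bv.
have y_stat x : b y x = m * a y x.
  pose p := \sum_(j < s) b x (u j.+1) *: u j.+1.
  have Wx : W (x - p).
    by apply: form_orthonormal_remainder => i j; rewrite u_on//.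
  have := rayleigh_stationary W_lin Wy b_le _ Wx; rewrite bym ay mulr1.
  have byp : b y p = 0.
    by rewrite symm_form_sumr big1// => j _; rewrite symm_formE Wy mulr0.
  have ayp : a y p = 0.
    rewrite symm_form_sumr big1// => j _.
    by rewrite symm_formE (symm_formC a) eigE// (symm_formC b _ y) Wy !mulr0.
  by rewrite !symm_formE byp ayp subr0 oppr0 addr0; exact.
have lam_le : lam s.+1 <= m^-1.
  rewrite leNgt; apply/negP => m_lt.
  have [|k [c [x [xu yE]]]] := u_all m^-1 y.
    split => //.
      by apply/eqP => y0; move: ay; rewrite y0 symm_form0l; lra.
    by move=> x _; rewrite y_stat mulKf// gt_eqF.
  suff : b y y = 0 by lra.
  rewrite {2}yE symm_form_sumr big1// => i _; rewrite symm_formE.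
  have [j [Ij lamj] <-] := xu i.
  have j_le_s : (j <= s)%N.
    rewrite leqNgt; apply/negP => sj.
    by have := lam_mono _ _ Is1 Ij sj; rewrite lamj leNgt m_lt.
  case: j Ij {lamj} j_le_s => [/I0//|j _ js].
  by rewrite (Wy (Ordinal js)) mulr0.
rewrite (le_trans (ler_wpM2l lam_ge0 (b_le _ v_orth)))// mulrA ler_piMl//.
by rewrite -ler_pdivlMr// div1r.
Qed.

(** * Signs of the form Q *)

(** The e_i are orthogonal for both a and b, so the same decomposition of a
    vector serves for all three terms of Q. *)
Lemma symm_form_split {R : realType} {V : lmodType R} (f : {symmetric V})
    (k : nat) (e : 'I_k -> V) (mu c d : 'I_k -> R) (x y : V) :
  (forall i j, f (e i) (e j) = mu i * (i == j)%:R) ->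
  (forall i, f x (e i) = 0) -> (forall i, f y (e i) = 0) ->
  f (x + \sum_i c i *: e i) (y + \sum_i d i *: e i) =
    f x y + \sum_i mu i * c i * d i.
Proof.
move=> e_diag x_orth y_orth; rewrite !symm_formE.
have -> : f x (\sum_i d i *: e i) = 0.
  by rewrite symm_form_sumr big1// => i _; rewrite symm_formE x_orth mulr0.
have -> : f (\sum_i c i *: e i) y = 0.
  rewrite symm_form_suml big1// => i _.
  by rewrite symm_formE symm_formC y_orth mulr0.
rewrite addr0 add0r symm_form_suml; congr (_ + _); apply: eq_bigr => i _.
rewrite symm_form_sumr (bigD1 i)//= big1 => [|j ji].
  by rewrite !symm_formE e_diag eqxx /=; ring.
by rewrite !symm_formE e_diag eq_sym (negbTE ji) !mulr0.
Qed.

(** The vector g stands for T v. Splitting off the e_i diagonalizes the three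
    terms at once and leaves a remainder v' orthogonal to all e_i, for which the
    gap gives T <= 1 / nu. *)
Lemma lehmann_form_ge0 {R : realType} {V : lmodType R} (a b : {symmetric V})
    (k : nat) (e : 'I_k -> V) (l : 'I_k -> R) (rho nu : R) (v g : V) :
  (forall x, 0 <= a x x) ->
  (forall i, 0 < l i) -> (forall i x, a (e i) x = l i * b (e i) x) ->
  (forall i j, b (e i) (e j) = (i == j)%:R) ->
  0 <= rho -> rho <= nu -> 0 < nu ->
  (forall x, (forall i, b x (e i) = 0) -> nu * b x x <= a x x) ->
  (forall i, b v (e i) = 0 \/ l i <= rho) ->
  (forall x, a g x = b v x) ->
  0 <= a v v - (rho + nu) * b v v + rho * nu * b g v.
Proof.
move=> a_ge0 l_gt0 eigE e_on rho_ge0 rho_le nu_gt0 gap v_orth gE.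
pose c i := b v (e i).
pose v' := v - \sum_i c i *: e i.
pose g' := g - \sum_i (c i / l i) *: e i.
have vE : v = v' + \sum_i c i *: e i by rewrite subrK.
have gE' : g = g' + \sum_i (c i / l i) *: e i by rewrite subrK.
have bv' i : b v' (e i) = 0 by apply: form_orthonormal_remainder.
have av' i : a v' (e i) = 0 by rewrite symm_formC eigE symm_formC bv' mulr0.
have g'E x : a g' x = b v' x.
  rewrite !symm_formE gE; congr (_ - _); rewrite !symm_form_suml.
  by apply: eq_bigr => i _; rewrite !symm_formE eigE mulrA divfK// gt_eqF.
have bg' i : b g' (e i) = 0.
  have := g'E (e i); rewrite bv' symm_formC eigE => /eqP.
  by rewrite mulf_eq0 gt_eqF//= symm_formC => /eqP.
clearbody v' g'.
have b_diag i j : b (e i) (e j) = 1 * (i == j)%:R by rewrite e_on mul1r.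
have a_diag i j : a (e i) (e j) = l i * (i == j)%:R by rewrite eigE e_on.
have -> : a v v = a v' v' + \sum_i l i * c i * c i.
  by rewrite {1 2}vE (symm_form_split _ _ a_diag).
have -> : b v v = b v' v' + \sum_i 1 * c i * c i.
  by rewrite {1 2}vE (symm_form_split _ _ b_diag).
have -> : b g v = b g' v' + \sum_i 1 * (c i / l i) * c i.
  by rewrite {1}gE' {1}vE (symm_form_split _ _ b_diag).
have rem_ge0 : 0 <= a v' v' - (rho + nu) * b v' v' + rho * nu * b g' v'.
  have := a_ge0 (v' - nu *: g').
  rewrite !symm_formE (symm_formC a v' g') !g'E (symm_formC b v' g') => sq_ge0.
  have := gap _ bv'; set A := a v' v' in sq_ge0 *; set B := b v' v' in sq_ge0 *.
  set G := b g' v' in sq_ge0 * => nuB.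
  (* (1 - rho T) (1 - nu T) is the combination of 1 - nu T and its square with
     weights 1 - rho / nu and rho / nu. *)
  have -> : A - (rho + nu) * B + rho * nu * G =
      (1 - rho / nu) * (A - nu * B) +
      rho / nu * (A + - (nu * B) + (- (nu * B) - - (nu * (nu * G)))).
    by field; rewrite gt_eqF.
  apply: addr_ge0; apply: mulr_ge0.
  - by rewrite subr_ge0 ler_pdivrMr// mul1r.
  - by rewrite subr_ge0.
  - by rewrite divr_ge0// ltW.
  - by move: sq_ge0; congr (_ <= _); ring.
have sum_ge0 : 0 <= \sum_i (c i ^+ 2 * ((rho - l i) * (nu - l i) / l i)).
  apply: sumr_ge0 => i _; have [c0|l_le] := v_orth i.
    by rewrite /c c0 expr0n mul0r.
  rewrite mulr_ge0 ?sqr_ge0// divr_ge0 ?(ltW (l_gt0 i))// mulr_ge0 ?subr_ge0//.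
  exact: le_trans l_le rho_le.
move: (addr_ge0 rem_ge0 sum_ge0); congr (_ <= _).
have -> : \sum_i (c i ^+ 2 * ((rho - l i) * (nu - l i) / l i)) =
    \sum_i l i * c i * c i - (rho + nu) * (\sum_i 1 * c i * c i)
    + rho * nu * \sum_i 1 * (c i / l i) * c i.
  rewrite !mulr_sumr -sumrB -big_split /=; apply: eq_bigr => i _.
  by field; rewrite gt_eqF.
ring.
Qed.

Lemma weighted_cauchy_schwarz {R : realFieldType} (k : nat)
    (c p q : 'I_k -> R) :
  (forall i, 0 < c i) ->
  (\sum_i p i * q i) ^+ 2 <=
    (\sum_i q i ^+ 2 / c i) * (\sum_i p i ^+ 2 * c i).
Proof.
move=> c_gt0.
set B := \sum_i p i * q i; set C := \sum_i q i ^+ 2 / c i.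
set A := \sum_i p i ^+ 2 * c i.
have term_ge0 i : 0 <= p i ^+ 2 * c i by rewrite mulr_ge0 ?sqr_ge0// ltW.
have A_ge0 : 0 <= A by exact: sumr_ge0.
have [A_gt0|A_le0] := ltP 0 A; last first.
  have /eqP : A = 0 by apply/eqP; rewrite eq_le A_le0.
  rewrite psumr_eq0// => /allP p0.
  suff -> : B = 0.
    rewrite expr0n /= mulr_ge0// sumr_ge0// => i _.
    by rewrite divr_ge0 ?sqr_ge0// ltW.
  apply: big1 => i _; have := p0 i (mem_index_enum i).
  by rewrite mulf_eq0 (gt_eqF (c_gt0 i)) orbF sqrf_eq0 => /eqP ->; rewrite mul0r.
(* In the c-weighted inner product, A q / c - B p is A times the component of
   q / c orthogonal to p. *)
have : 0 <= \sum_i c i * (A * q i / c i - B * p i) ^+ 2.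
  by apply: sumr_ge0 => i _; rewrite mulr_ge0 ?sqr_ge0// ltW.
have -> : \sum_i c i * (A * q i / c i - B * p i) ^+ 2 =
    A ^+ 2 * C - 2 * A * B * B + B ^+ 2 * A.
  transitivity (\sum_i (A ^+ 2 * (q i ^+ 2 / c i) - 2 * A * B * (p i * q i)
                        + B ^+ 2 * (p i ^+ 2 * c i))).
    by apply: eq_bigr => i _; field; rewrite gt_eqF.
  by rewrite big_split sumrB -!mulr_sumr.
have -> : A ^+ 2 * C - 2 * A * B * B + B ^+ 2 * A = A * (C * A - B ^+ 2) by ring.
by rewrite pmulr_rge0// subr_ge0.
Qed.

(** The U i are trial eigenfunctions, w i their residuals and g is T v, obtained
    from T (U i) = (U i - w i) / l i. The hypothesis on rho says that the
    coefficient of (nu - l i) d_i^2 in the resulting bound on Q is negative. *)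
Lemma lehmann_form_lt0 {R : realType} {V : normedModType R}
    (a b : {symmetric V}) (k : nat) (U w : 'I_k -> V) (l eta d : 'I_k -> R)
    (rho nu : R) :
  (forall v : V, `|v| ^+ 2 = a v v) ->
  (forall i, 0 < l i) -> (forall i, l i < nu) ->
  (forall i j, b (U i) (U j) = (i == j)%:R) ->
  (forall i j, a (U i) (U j) = l i * b (U i) (U j)) ->
  (forall i x, a (w i) x = a (U i) x - l i * b (U i) x) ->
  (forall i, `|w i| <= eta i) ->
  0 < nu -> 0 <= rho ->
  (forall i, rho / l i +
     rho * nu * (\sum_j eta j ^+ 2 / (l j ^+ 2 * (nu - l j))) < 1) ->
  (exists i, d i != 0) ->
  let v := \sum_i d i *: U i in
  exists g, (forall x, a g x = b v x) /\
    a v v - (rho + nu) * b v v + rho * nu * b g v < 0.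
Proof.
move=> a_norm l_gt0 l_lt b_on a_diag wE w_le nu_gt0 rho_ge0 rho_lt [i0 d_neq0] v.
set S := \sum_j _ in rho_lt.
have l_neq0 i : l i != 0 by rewrite gt_eqF.
have nul_gt0 i : 0 < nu - l i by rewrite subr_gt0.
have wU i j : a (w i) (U j) = 0 by rewrite wE a_diag subrr.
have b_diag i j : b (U i) (U j) = 1 * (i == j)%:R by rewrite b_on mul1r.
have {}a_diag i j : a (U i) (U j) = l i * (i == j)%:R by rewrite a_diag b_on.
pose z := \sum_i (d i / l i) *: w i.
have zU i : a (- z) (U i) = 0.
  rewrite symm_formE symm_form_suml big1 ?oppr0// => j _.
  by rewrite symm_formE wU mulr0.
pose g := - z + \sum_i (d i / l i) *: U i.
have gE x : a g x = b v x.
  rewrite !symm_formE !symm_form_suml -sumrN -big_split /=.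
  by apply: eq_bigr => i _; rewrite !symm_formE wE; field.
exists g; split=> //.
have avv : a v v = \sum_i l i * d i * d i.
  rewrite -[in LHS](add0r v) (symm_form_split _ _ a_diag) ?symm_form0l ?add0r//;
  by move=> i; rewrite symm_form0l.
have bvv : b v v = \sum_i 1 * d i * d i.
  rewrite -[in LHS](add0r v) (symm_form_split _ _ b_diag) ?symm_form0l ?add0r//;
  by move=> i; rewrite symm_form0l.
(* b(g, v) = a(g, g), and the residual part of g is a-orthogonal to the rest. *)
have bgv : b g v = a z z + \sum_i l i * (d i / l i) * (d i / l i).
  rewrite symm_formC -gE (symm_form_split _ _ a_diag)//.
  by congr (_ + _); rewrite !symm_formE opprK.
have azz : a z z <= S * \sum_i d i ^+ 2 * (nu - l i).
  apply: (@le_trans _ _ ((\sum_i `|d i| * (eta i / l i)) ^+ 2)).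
    rewrite -a_norm lerXn2r ?nnegrE ?sumr_ge0//.
      move=> i _; rewrite mulr_ge0// divr_ge0 ?(ltW (l_gt0 i))//.
      exact: le_trans (w_le i).
    apply: le_trans (ler_norm_sum _ _ _) _; apply: ler_sum => i _.
    rewrite normrZ normrM normfV (gtr0_norm (l_gt0 i)) mulrAC -mulrA.
    by rewrite ler_wpM2l// ler_wpM2r ?invr_ge0 ?(ltW (l_gt0 i)).
  have SE : \sum_i (eta i / l i) ^+ 2 / (nu - l i) = S.
    by apply: eq_bigr => i _; field; rewrite l_neq0 gt_eqF.
  have dE : \sum_i `|d i| ^+ 2 * (nu - l i) = \sum_i d i ^+ 2 * (nu - l i).
    by apply: eq_bigr => i _; rewrite real_normK ?num_real.
  rewrite -SE -dE.
  exact: (weighted_cauchy_schwarz (fun i => `|d i|) (fun i => eta i / l i)).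
(* S is a constant from here on: distributing products over sums must not
   reach inside it. *)
clearbody S.
pose t i := d i ^+ 2 * ((nu - l i) * (1 - (rho / l i + rho * nu * S))).
have t_ge0 i : 0 <= t i.
  by rewrite mulr_ge0 ?sqr_ge0// mulr_ge0// ltW// subr_gt0.
have t_gt0 : 0 < \sum_i t i.
  rewrite (bigD1 i0)//= ltr_pwDl ?sumr_ge0// mulr_gt0 ?exprn_even_gt0//.
  by rewrite mulr_gt0// subr_gt0.
have rn_ge0 : 0 <= rho * nu by rewrite mulr_ge0// ltW.
rewrite avv bvv bgv mulrDr.
have := ler_wpM2l rn_ge0 azz.
suff : \sum_i l i * d i * d i - (rho + nu) * (\sum_i 1 * d i * d i) +
   rho * nu * (\sum_i l i * (d i / l i) * (d i / l i)) +
   rho * nu * (S * \sum_i d i ^+ 2 * (nu - l i)) = - \sum_i t i by lra.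
rewrite (mulrA _ S) !mulr_sumr -sumrB -!big_split -sumrN /=.
by apply: eq_bigr => i _; rewrite /t; field.
Qed.

Lemma nonzero_orthogonal_combination {F : fieldType} (k : nat)
    (M : 'I_k.+1 -> 'I_k -> F) :
  exists d : 'I_k.+1 -> F,
    (exists i, d i != 0) /\ forall j, \sum_i d i * M i j = 0.
Proof.
pose A := \matrix_(i, j) M i j.
have : kermx A != 0.
  rewrite -mxrank_eq0 mxrank_ker -lt0n subn_gt0.
  exact: leq_ltn_trans (rank_leq_col A) _.
move=> /rowV0Pn [x /sub_kermxP xA x_neq0].
exists (x 0); split.
  have /rV0Pn[i xi] := x_neq0; by exists i.
move=> j; have /matrixP /(_ 0 j) := xA; rewrite !mxE => xAj.
by rewrite -[RHS]xAj; apply: eq_bigr => i _; rewrite [A _ _]mxE.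
Qed.

(** * The lower bound *)

Theorem theorem2p5 (R : realType) (V : completeNormedModType R)
  (a : {dot V for idfun}) (b : {symmetric V})
  (a_norm : forall v : V, `|v| = form_norm a v)
  (b_ge0 : forall v : V, 0 <= b v v)
  (b_cont : continuous (fun p : V * V => b p.1 p.2 : R))
  (b_compact : compact_seminorm (form_norm b))
  (I : set nat) (lam : nat -> R) (u : nat -> V)
  (I_segment : initial_segment I)
  (lam_u : eigen_listing a b setT I lam u)
  (r s : nat) (r_ge1 : (1 <= r)%N) (r_le_s : (r <= s)%N)
  (ut : nat -> V) (Vt : set V)
  (Vt_def : Vt = lspan (ut @` [set i | (r <= i <= s)%N]))
  (lamt : nat -> R) (us : nat -> V)
  (lamt_us : eigen_listing a b Vt [set i | (r <= i <= s)%N] lamt us)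
  (lamt_gt0 : forall i, (r <= i <= s)%N -> 0 < lamt i)
  (nu : R) (nu_gt0 : 0 < nu)
  (lam_pred_s : (1 < s)%N -> lam s.-1 <= lamt s)
  (lamt_lt_nu : lamt s < nu)
  (I_succ_s : I s.+1) (nu_le : nu <= lam s.+1)
  (w : nat -> V)
  (w_def : forall i, (r <= i <= s)%N ->
     forall v : V, a (w i) v = a (us i) v - lamt i * b (us i) v)
  (eta : nat -> R)
  (eta_gt0 : forall i, (r <= i <= s)%N -> 0 < eta i)
  (eta_ge : forall i, (r <= i <= s)%N -> form_norm a (w i) <= eta i) :
  forall n, (r <= n <= s)%N ->
    lamt n * (1 + nu * lamt n *
      \sum_(n <= i < s.+1) eta i ^+ 2 / (lamt i ^+ 2 * (nu - lamt i)))^-1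
    <= lam n.
Proof.
move=> n /andP[r_le_n n_le_s].
have n_gt0 : (0 < n)%N by exact: leq_trans r_ge1 r_le_n.
have a_gt0 v : v != 0 -> 0 < (a : {symmetric V}) v v.
  exact: (@neq0_dnorm_gt0 _ _ _ a v).
have a_ge0 v : 0 <= (a : {symmetric V}) v v.
  have [->|v_neq0] := eqVneq v 0; first by rewrite symm_form0l.
  exact/ltW/a_gt0.
have sqr_norm v : `|v| ^+ 2 = (a : {symmetric V}) v v.
  by rewrite a_norm; exact: form_norm_sqr.
have gap := spectral_gap sqr_norm b_cont b_compact I_segment lam_u I_succ_s.
have [I0 I_seg] := I_segment.
have [u_eig u_on lam_mono _] := lam_u.
have [us_eig us_on lamt_mono _] := lamt_us.
have Iu j : (0 < j <= s)%N -> I j.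
  by move=> /andP[j0 js]; apply: I_seg I_succ_s; rewrite j0 ltnW.
have lam_gt0 j : (0 < j <= s)%N -> 0 < lam j.
  move=> /Iu Ij; have [_ uj0 uE] := u_eig _ Ij.
  have : 0 < a (u j) (u j) by exact: a_gt0.
  by rewrite uE// u_on// eqxx mulr1.
set S := \sum_(_ <= _ < _) _.
pose k := (s - n)%N.
have range (i : 'I_k.+1) : (r <= n + i <= s)%N.
  rewrite (leq_trans r_le_n (leq_addr _ _))/= -(subnKC n_le_s) leq_add2l.
  by rewrite -ltnS.
have SE : S = \sum_(i < k.+1) eta (n + i)%N ^+ 2 /
    (lamt (n + i)%N ^+ 2 * (nu - lamt (n + i)%N)).
  rewrite /S -{1}(add0n n) big_addn subSn// big_mkord.
  by apply: eq_bigr => i _; rewrite addnC.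
have n_range : (r <= n <= s)%N by rewrite r_le_n.
have lt_nu i : (r <= i <= s)%N -> lamt i < nu.
  move=> ri; apply: le_lt_trans lamt_lt_nu; apply: lamt_mono => //=.
    by rewrite r_le_s /=.
  by case/andP: ri.
have S_ge0 : 0 <= S.
  rewrite SE sumr_ge0// => i _; rewrite divr_ge0 ?sqr_ge0// mulr_ge0 ?sqr_ge0//.
  by rewrite subr_ge0 ltW ?lt_nu.
have lamtn_gt0 := lamt_gt0 _ n_range.
have nlS_ge0 : 0 <= nu * lamt n * S.
  by apply: mulr_ge0 => //; apply: mulr_ge0; apply: ltW.
have den_gt0 : 0 < 1 + nu * lamt n * S by lra.
rewrite leNgt; apply/negP; rewrite ltr_pdivlMr// => lam_lt.
have lamn_gt0 : 0 < lam n by rewrite lam_gt0// n_gt0.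
have rho_lt (i : 'I_k.+1) : lam n / lamt (n + i)%N + lam n * nu *
   (\sum_(j < k.+1) eta (n + j)%N ^+ 2 /
    (lamt (n + j)%N ^+ 2 * (nu - lamt (n + j)%N))) < 1.
  rewrite -SE; apply: (@le_lt_trans _ _ (lam n / lamt n + lam n * nu * S)).
    rewrite lerD2r ler_wpM2l ?(ltW lamn_gt0)// lef_pV2 ?posrE ?lamt_gt0//.
    by apply: lamt_mono => //=; rewrite ?range ?leq_addr.
  rewrite -(ltr_pM2r lamtn_gt0) mul1r; move: lam_lt; congr (_ < _).
  by field; rewrite gt_eqF.
(* A nonzero trial vector b-orthogonal to u_(n+1), ..., u_s. *)
have [d [d_neq0 d_orth]] := nonzero_orthogonal_combination
  (fun (i : 'I_k.+1) (j : 'I_k) => b (us (n + i)%N) (u (n + j).+1)).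
have us_on' (i j : 'I_k.+1) : b (us (n + i)%N) (us (n + j)%N) = (i == j)%:R.
  by rewrite us_on ?eqn_add2l//=.
have us_diag (i j : 'I_k.+1) :
    (a : {symmetric V}) (us (n + i)%N) (us (n + j)%N) =
    lamt (n + i)%N * b (us (n + i)%N) (us (n + j)%N).
  have [_ _ usE] := us_eig _ (range i); apply: usE.
  by have [] := us_eig _ (range j).
have w_le (i : 'I_k.+1) : `|w (n + i)%N| <= eta (n + i)%N.
  by rewrite a_norm eta_ge.
have [g [gE]] := lehmann_form_lt0 sqr_norm (fun i => lamt_gt0 _ (range i))
  (fun i => lt_nu _ (range i)) us_on' us_diag (fun i => w_def _ (range i))
  w_le nu_gt0 (ltW lamn_gt0) rho_lt d_neq0.
set v := \sum_i _ in gE *; rewrite ltNge => /negP; apply.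
have lamn_le_nu : lam n <= nu.
  apply: ltW; apply: lt_trans (lt_nu _ n_range); apply: le_lt_trans lam_lt.
  by rewrite ler_peMr ?(ltW lamn_gt0)// lerDl.
have ord_range (i : 'I_s) : (0 < i.+1 <= s)%N by rewrite /=.
apply: (@lehmann_form_ge0 _ _ _ _ s (fun i => u i.+1) (fun i => lam i.+1)) => //.
- by move=> i; apply: lam_gt0; apply: ord_range.
- by move=> i x; have [_ _ uE] := u_eig _ (Iu _ (ord_range i)); apply: uE.
- by move=> i j; rewrite u_on ?eqSS//; apply: Iu; apply: ord_range.
- exact: ltW.
- move=> x /gap; apply: le_trans; exact: ler_wpM2r.
- move=> i; have [i_lt_n|n_le_i] := ltnP i n.
    right; apply: lam_mono => //; apply: Iu; last by rewrite n_gt0.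
    exact: ord_range.
  left; have ik : (i - n < k)%N by rewrite ltn_sub2r// (leq_ltn_trans n_le_i).
  rewrite -(d_orth (Ordinal ik)) /= subnKC// symm_form_suml.
  by apply: eq_bigr => j _; rewrite symm_formE.
Qed.
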